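(* Let $\mathcal P\subseteq \mathbb N\times\mathbb N$ be a pattern. The following are equivalent: (1) $\mathcal P$ is Schur bounded; (2) $\mathcal P$ is the union of a row finite set and a column finite set; (3) $\displaystyle\sup_{R,C\subseteq\mathbb N \text{ finite, not both empty}}\frac{|\mathcal P\cap(R\times C)|}{|R|+|C|}<\infty$. Moreover, when these hold, let $m$ be the least integer dominating the supremum in (3). Then $m$ is also the least integer $k$ such that $\mathcal P$ is the union of a set row bounded by $k$ and a set column bounded by $k$, and the Schur bound satisfies \[\frac{\sqrt m}{4}\le \mathfrak s(\mathcal P)\le 2\sqrt m.\]
   Context: For a (finite or infinite) matrix $A=[a_{ij}]$, the Schur multiplier $S_A$ acts on bounded operators $T=[t_{ij}]$ on $\ell^2$ by $S_A(T)=[a_{ij}t_{ij}]$; $\|A\|_m$ denotes the norm of $S_A$ as a map on $\mathcal B(\ell^2)$ (possibly $+\infty$). A pattern is a subset $\mathcal P\subseteq\mathbb N\times\mathbb N$; a matrix is supported on $\mathcal P$ if its nonzero entries lie in $\mathcal P$. $\mathcal S(\mathcal P)$ is the set of matrices supported on $\mathcal P$ with all entries of modulus at most $1$. $\mathcal P$ is Schur bounded if every $X\in\mathcal S(\mathcal P)$ gives a bounded Schur multiplier, and $\mathfrak s(\mathcal P)=\sup_{X\in\mathcal S(\mathcal P)}\|X\|_m$. A pattern is row bounded by $k$ if each row contains at most $k$ elements of the pattern, and row finite if it is row bounded by some $k\in\mathbb N$; column bounded by $k$ and column finite are defined analogously with columns. *)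

(* Defs.v *)
From HB Require Import structures.
From mathcomp Require Import all_boot all_order all_algebra.
From mathcomp Require Import boolp classical_sets reals constructive_ereal ereal.
From mathcomp Require Import complex.
Set Implicit Arguments. Unset Strict Implicit. Unset Printing Implicit Defensive.
Import Order.TTheory GRing.Theory Num.Theory.
Local Open Scope ring_scope.
Local Open Scope classical_set_scope.

Section SchurDefs.
Variable R : realType.
Local Notation C := R[i].

Definition mat := nat -> nat -> C.

Definition l2sq (n : nat) (x : nat -> C) : R :=
  \sum_(i < n) (Normc.normc (x i)) ^+ 2.

Definition bilin (T : mat) (n : nat) (x y : nat -> C) : C :=
  \sum_(i < n) \sum_(j < n) conjc (y i) * T i j * x j.

(* Operator norm on l^2 of the (densely defined) operator with matrix T,
   possibly +oo: sup of |<T x, y>| over finitely supported x, y in the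
   closed unit ball. *)
Definition opnorm (T : mat) : \bar R :=
  ereal_sup [set r | exists (n : nat) (x y : nat -> C),
     [/\ l2sq n x <= 1, l2sq n y <= 1 & r = (Normc.normc (bilin T n x y))%:E]].

Definition bounded_op (T : mat) : Prop := (opnorm T < +oo)%E.

Definition schur (A T : mat) : mat := fun i j => A i j * T i j.

Definition mnorm (A : mat) : \bar R :=
  ereal_sup [set opnorm (schur A T) | T in [set T | bounded_op T /\ (opnorm T <= 1%:E)%E]].

Definition pattern := set (nat * nat).

Definition supported_on (A : mat) (P : pattern) : Prop :=
  forall i j, A i j != 0 -> P (i, j).

Definition SP (P : pattern) : set mat :=
  [set X | supported_on X P /\ forall i j, Normc.normc (X i j) <= 1].

Definition schur_bounded (P : pattern) : Prop :=
  forall X, SP P X -> (mnorm X < +oo)%E.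

Definition schur_bound (P : pattern) : \bar R := ereal_sup [set mnorm X | X in SP P].

Definition row_bounded_by (k : nat) (Q : pattern) : Prop :=
  forall i, exists s : seq nat, (size s <= k)%N /\ forall j, Q (i, j) -> j \in s.
Definition col_bounded_by (k : nat) (Q : pattern) : Prop :=
  forall j, exists s : seq nat, (size s <= k)%N /\ forall i, Q (i, j) -> i \in s.
Definition row_finite (Q : pattern) : Prop := exists k, row_bounded_by k Q.
Definition col_finite (Q : pattern) : Prop := exists k, col_bounded_by k Q.

(* |P \cap (R x C)| for finite sets R, C given as duplicate-free lists. *)
Definition count_in (P : pattern) (Rs Cs : seq nat) : nat :=
  \sum_(i <- Rs) \sum_(j <- Cs) (if `[< P (i, j) >] then 1 else 0)%N.

Definition density_sup (P : pattern) : \bar R :=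
  ereal_sup [set r | exists Rs Cs : seq nat,
     [/\ uniq Rs, uniq Cs, (0 < size Rs + size Cs)%N &
         r = ((count_in P Rs Cs)%:R / (size Rs + size Cs)%:R)%:E]].

End SchurDefs.

(* Main.v *)
Require Import Defs.
From HB Require Import structures.
From mathcomp Require Import all_boot all_order all_algebra finmap.
From mathcomp Require Import boolp classical_sets reals constructive_ereal ereal.
From mathcomp Require Import complex.
From mathcomp Require Import zify ring lra.
Set Implicit Arguments. Unset Strict Implicit. Unset Printing Implicit Defensive.
Import Order.TTheory GRing.Theory Num.Theory.
Local Open Scope ring_scope.
Local Open Scope classical_set_scope.

(* Hall's condition: the density bound says that any finite set of positions
   of [P] has at most [m] times as many elements as there are lines (rows and
   columns) meeting it. By submodularity each position can then be assigned to
   its row or to its column, one position at a time, keeping this condition; at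
   the end every line receives at most [m] positions.

   Upper bound: if [X] has at most [k] entries per row, then
   [<S_X(T) x, y> = \sum_j x_j <T e_j, y^(j)>] with
   [\sum_j |y^(j)|^2 <= k |y|^2], so Cauchy-Schwarz gives [|X|_m <= sqrt k].

   Lower bound: a violation of the density bound [m - 1] contains a finite
   pattern [Q] all of whose row degrees [d_i] and column degrees [d'_j] are at
   least [m]. With [u_i^2 = d_i / |Q|], [v_j^2 = d'_j / |Q|], the functional
   [L b = \sum_Q u_i v_j b_ij] reaches [sqrt m] on the set of [b] whose rows and
   columns have l2 norm at most 1, at [b_ij = max (d_i, d'_j) ^ (-1/2)]. For
   random signs [e] put [Y = (e_ij b_ij)] and [Z = Y (1 + Y^T Y / 4)^-1]; then [Z]
   is a contraction, [Y - Z = Y Y^T Z / 4], and since only paired signs survive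
   in the mean of the squared entries of a row of [Y Y^T] (or [Y^T Y]), the mean
   of [e_ij (Y - Z)_ij] lies in half the ball. Evaluating at a near-maximiser
   [b] of [L], some choice of signs gives [L (e_ij Z_ij) >= sqrt m / 4], which is
   the value of a form [<S_e(Z) v, u>].

   If the density is infinite it stays so after deleting finitely many rows and
   columns, so such blocks of unbounded multiplier norm can be placed diagonally
   in a single matrix. *)

(** * Orienting patterns *)

Section Orientation.
Variables (T : countType) (V : choiceType) (r c : T -> V) (P : set T) (m : nat).
Local Open Scope fset_scope.

(** [N e] holds the lines to which [e] may still be assigned; with [m] copies of each line this is
    Hall's marriage condition. *)
Definition hall (N : T -> {fset V}) : Prop :=
  forall E : {fset T}, (forall e, e \in E -> P e) ->
    (#|` E| <= m * #|` \bigcup_(e <- E) N e|)%N.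

Definition upd (N : T -> {fset V}) t x : T -> {fset V} :=
  fun e => if e == t then [fset x] else N e.

(** If both restrictions fail, the violating sets [E1] and [E2] contain [t]. Let [A] be [x] together
    with the lines of [E1] minus [t], and [B] be [y] together with those of [E2] minus [t]; then
    [m |A| + m |B| <= |E1| + |E2| - 2]. Hall's condition for the union of [E1] and [E2], and for
    their intersection minus [t], bounds [|E1| + |E2| - 1] by [m |A| + m |B|], a contradiction. *)
Lemma hall_step N t x y : hall N -> N t = [fset x; y] ->
  hall (upd N t x) \/ hall (upd N t y).
Proof.
have main z : ~ hall (upd N t z) -> hall N ->
  exists E : {fset T}, [/\ forall e, e \in E -> P e, t \in E &
    (m * #|` z |` \bigcup_(e <- E `\ t) N e| < #|` E|)%N].
  move=> nh hN.
  have [E /not_implyP[EP /negP]] := (@existsNP _ _).2 nh.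
  rewrite -ltnNge => Elt.
  have tE : t \in E.
    apply/negPn/negP => tE; move: Elt; apply/negP; rewrite -leqNgt.
    have -> : \bigcup_(e <- E) upd N t z e = \bigcup_(e <- E) N e.
      apply: eq_big_seq => e eE; rewrite /upd; case: eqP => // et.
      by rewrite -et eE in tE.
    exact: hN.
  exists E; split=> //; apply: leq_ltn_trans Elt; rewrite leq_mul2l.
  apply/orP; right; apply: fsubset_leq_card; apply/fsubsetP => v.
  rewrite !inE => /orP[/eqP->|/bigfcupP[e]].
    by apply/bigfcupP; exists t; rewrite ?tE// /upd eqxx inE.
  rewrite andbT !inE => /andP[et eE] ve; apply/bigfcupP; exists e.
    by rewrite eE.
  by rewrite /upd (negPf et).
move=> hN Nt; have [h|/main/(_ hN)] := pselect (hall (upd N t x)); first by left.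
move=> [E1 [E1P tE1 lt1]]; right; apply: contrapT => /main/(_ hN).
move=> [E2 [E2P tE2 lt2]].
set A := (X in #|` X|) in lt1; set B := (X in #|` X|) in lt2.
have subU : \bigcup_(e <- E1 `|` E2) N e `<=` A `|` B.
  apply/fsubsetP => v /bigfcupP[e]; rewrite andbT !inE => eE ve.
  have [et|et] := eqVneq e t.
    by move: ve; rewrite et Nt !inE => /orP[]/eqP->; rewrite eqxx ?orbT.
  case/orP: eE => eE; apply/orP; [left|right]; apply/orP; right;
    by apply/bigfcupP; exists e => //; rewrite !inE et eE.
(* Here [t] has to be left out: its lines [x] and [y] need not lie in both [A] and [B]. *)
have subI : \bigcup_(e <- (E1 `&` E2) `\ t) N e `<=` A `&` B.
  apply/fsubsetP => v /bigfcupP[e]; rewrite andbT !inE => /and3P[et e1 e2] ve.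
  by apply/andP; split; apply/orP; right; apply/bigfcupP;
    exists e => //; rewrite !inE et ?e1 ?e2.
have hU := hN (E1 `|` E2) _.
have hI := hN ((E1 `&` E2) `\ t) _.
have {}hU : (#|` E1 `|` E2| <= m * #|` A `|` B|)%N.
  apply: leq_trans (hU _) _; last by rewrite leq_mul2l fsubset_leq_card ?orbT.
  by move=> e; rewrite inE => /orP[/E1P|/E2P].
have {}hI : (#|` (E1 `&` E2) `\ t| <= m * #|` A `&` B|)%N.
  apply: leq_trans (hI _) _; last by rewrite leq_mul2l fsubset_leq_card ?orbT.
  by move=> e; rewrite !inE => /and3P[_ /E1P].
have := cardfsUI E1 E2; have /(congr1 (muln m)) := cardfsUI A B.
have := cardfsD1 t (E1 `&` E2); rewrite !inE tE1 tE2 /= !mulnDr.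
move: hU hI lt1 lt2.
move: (m * #|` A|)%N (m * #|` B|)%N (m * #|` A `|` B|)%N (m * #|` A `&` B|)%N.
move: #|` E1| #|` E2| #|` E1 `|` E2| #|` E1 `&` E2| #|` (E1 `&` E2) `\ t|.
clear=> *; lia.
Qed.

Definition refine N t : T -> {fset V} :=
  if `[< hall (upd N t (r t)) >] then upd N t (r t) else upd N t (c t).

(** Positions are decided in the order of their codes; [pickle_inv] returns [t] only at the code of
    [t], so each position is decided exactly once. *)
Fixpoint stage k : T -> {fset V} :=
  if k is k'.+1 then
    if pickle_inv k' is Some t then refine (stage k') t else stage k'
  else fun e => [fset r e; c e].

Lemma refine_out N t e : e != t -> refine N t e = N e.
Proof. by rewrite /refine; case: ifP => _ /negPf et; rewrite /upd et. Qed.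

Lemma stageS k : stage k.+1 =
  if pickle_inv k is Some t then refine (stage k) t else stage k.
Proof. by []. Qed.

Lemma stage_undecided k e : (k <= choice.pickle e)%N -> stage k e = [fset r e; c e].
Proof.
elim: k => [|k IH] ke; first by [].
rewrite stageS; case E: (pickle_inv k) => [t|]; last exact: IH (ltnW ke).
rewrite refine_out; first exact: IH (ltnW ke).
apply/eqP => et.
by move: (@pickle_invK T k) ke; rewrite E /= -et => ->; rewrite ltnn.
Qed.

Lemma stage_decided k e : (choice.pickle e < k)%N ->
  stage k e = stage (choice.pickle e).+1 e.
Proof.
elim: k => // k IH; rewrite ltnS leq_eqVlt => /orP[/eqP->//|ek].
rewrite -(IH ek) stageS; case E: (pickle_inv k) => [t|] //.
rewrite refine_out//; apply/eqP => et.
by move: (@pickle_invK T k) ek; rewrite E /= -et => ->; rewrite ltnn.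
Qed.

Lemma stageS_pickle e : stage (choice.pickle e).+1 e = [fset r e] \/
  stage (choice.pickle e).+1 e = [fset c e].
Proof.
rewrite stageS pickleK_inv /refine.
by case: ifP => _; rewrite /upd eqxx; [left|right].
Qed.

Lemma hall_stage k : hall (fun e => [fset r e; c e]) -> hall (stage k).
Proof.
move=> h0; elim: k => [|k IH]; first exact: h0.
rewrite stageS; case E: (pickle_inv k) => [t|]; last exact: IH.
rewrite /refine; case: asboolP => // nh.
have st : stage k t = [fset r t; c t].
  by apply: stage_undecided; move: (@pickle_invK T k); rewrite E /= => ->.
by case: (hall_step IH st).
Qed.

(* Each edge is decided at a finite stage, so the limit of the stages inherits
   the Hall condition: no compactness argument is needed. *)
Lemma orientation : hall (fun e => [fset r e; c e]) ->
  exists o : T -> bool, hall (fun e => [fset if o e then r e else c e]).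
Proof.
move=> h0; exists (fun e => `[< stage (choice.pickle e).+1 e = [fset r e] >]).
move=> E EP; pose k := (\max_(e <- E) (choice.pickle e).+1)%N.
rewrite (eq_big_seq (stage k)) ?(hall_stage k h0 EP)// => e eE.
rewrite (@stage_decided k) ?leq_bigmax_seq//.
by case: asboolP => // ns; case: (stageS_pickle e).
Qed.

End Orientation.

(** * Density bounds and row/column decompositions *)

(** A duplicate-free list in [J] that does not yet cover [J] can be lengthened, so without a cover
    of length at most [m] one would reach length [m + 1]. *)
Lemma small_set_cover (J : set nat) (m : nat) :
  (forall s, uniq s -> (forall j, j \in s -> J j) -> (size s <= m)%N) ->
  exists s : seq nat, (size s <= m)%N /\ forall j, J j -> j \in s.
Proof.
move=> bnd; apply: contrapT => ncov.
have grow k : (k <= m.+1)%N ->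
    exists s, [/\ uniq s, forall j, j \in s -> J j & size s = k].
  elim: k => [|k IH] km; first by exists [::].
  have [s [us sJ sk]] := IH (ltnW km).
  have [j [Jj js]] : exists j, J j /\ j \notin s.
    apply: contrapT => nj; apply: ncov; exists s; split; first by rewrite sk.
    by move=> j Jj; apply/negPn/negP => js; apply: nj; exists j.
  exists (j :: s); split; rewrite /= ?js ?sk// => i.
  by rewrite inE => /orP[/eqP->//|/sJ].
have [s [us sJ sk]] := grow _ (leqnn _).
by have := bnd s us sJ; rewrite sk ltnn.
Qed.

Lemma count_inE P Rs Cs : count_in P Rs Cs =
  size [seq e <- [seq (i, j) | i <- Rs, j <- Cs] | `[< P e >]].
Proof.
rewrite /count_in size_filter -sum1_count [RHS]big_mkcond big_allpairs.
by apply: eq_bigr => i _; apply: eq_bigr => j _; case: ifP.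
Qed.

Lemma decomposition_of_density (P : pattern) (m : nat) :
  (forall Rs Cs, uniq Rs -> uniq Cs ->
     (count_in P Rs Cs <= m * (size Rs + size Cs))%N) ->
  exists A B : pattern,
    [/\ P = A `|` B, row_bounded_by m A & col_bounded_by m B].
Proof.
move=> dens.
(* The tag keeps row [i] and column [i] apart as lines. *)
pose r (e : nat * nat) := (true, e.1); pose c (e : nat * nat) := (false, e.2).
have h0 : hall P m (fun e => [fset r e; c e]%fset).
  move=> E EP; set N := (\bigcup_(e <- E) _)%fset.
  pose Rs : seq nat := [fset v.2 | v in N & v.1]%fset.
  pose Cs : seq nat := [fset v.2 | v in N & ~~ v.1]%fset.
  have sz : (size Rs + size Cs <= #|` N|)%N.
    have card_part (p : pred (bool * nat)) :
        (#|` [fset v.2 | v in N & p v]%fset| <= count p N)%N.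
      rewrite -size_filter -(size_map snd) uniq_leq_size//.
      move=> x /imfsetP[v /=]; rewrite inE => /andP[vN pv] ->.
      by apply: map_f; rewrite mem_filter pv.
    apply: leq_trans (leq_add (card_part fst) (card_part (predC fst))) _.
    by rewrite count_predC.
  apply: leq_trans (leq_trans (dens Rs Cs _ _) _); rewrite ?fset_uniq//; last first.
    by rewrite leq_mul2l sz orbT.
  rewrite count_inE; apply: uniq_leq_size; first exact: fset_uniq.
  move=> e eE; rewrite mem_filter; apply/andP; split.
    by apply/asboolP/EP.
  have mN v : v \in [fset r e; c e]%fset -> v \in N.
    by move=> ve; apply/bigfcupP; exists e => //; rewrite eE.
  apply/allpairsP; exists e; split; last by case: e {eE mN}.
    by apply/imfsetP; exists (r e) => //=; rewrite inE mN// !inE eqxx.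
  by apply/imfsetP; exists (c e) => //=; rewrite inE mN// !inE eqxx orbT.
have [o ho] := orientation h0.
(* The positions assigned to one line [v] have [v] as their only line, so Hall's condition leaves at
   most [m] of them. *)
have small (v : bool * nat) (mk : nat -> nat * nat) (J : set nat) : injective mk ->
    (forall j, J j -> P (mk j) /\ (if o (mk j) then r (mk j) else c (mk j)) = v) ->
    exists s : seq nat, (size s <= m)%N /\ forall j, J j -> j \in s.
  move=> mki JP; apply: small_set_cover => s us sJ.
  pose E := [fset mk j | j in s]%fset.
  have cE : #|` E| = size s.
    by rewrite card_imfset//= undup_id.
  rewrite -cE; apply: leq_trans (ho E _) _.
    by move=> e /imfsetP[j /= /sJ/JP[Pj _] ->].
  rewrite -[X in (_ <= X)%N]muln1 leq_mul2l -(cardfs1 v); apply/orP; right.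
  apply: fsubset_leq_card; apply/fsubsetP => w /bigfcupP[e]; rewrite andbT.
  by move=> /imfsetP[j /= /sJ/JP[_ <-] ->].
exists [set e | P e /\ o e], [set e | P e /\ ~~ o e]; split.
- apply/seteqP; split => e /=; last by case=> -[].
  by move=> Pe; case: (boolP (o e)) => oe; [left|right].
- move=> i; apply: (small (true, i) (fun j => (i, j))) => [x y []//|j /= [Pj ->]].
  by [].
- move=> j; apply: (small (false, j) (fun i => (i, j))) => [x y []//|i /= [Pi]].
  by move=> /negPf ->.
Qed.

Lemma count_inU (A B P : pattern) Rs Cs : P `<=` A `|` B ->
  (count_in P Rs Cs <= count_in A Rs Cs + count_in B Rs Cs)%N.
Proof.
move=> PAB.
rewrite /count_in -big_split leq_sum// => i _; rewrite -big_split leq_sum// => j _.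
case: asboolP => // /PAB [Aij|Bij]; first by rewrite (asboolT Aij).
by rewrite (asboolT Bij) /= addn1.
Qed.

Lemma count_in_decomposition (A B P : pattern) (k : nat) :
  P `<=` A `|` B -> row_bounded_by k A -> col_bounded_by k B ->
  forall Rs Cs, uniq Rs -> uniq Cs ->
    (count_in P Rs Cs <= k * (size Rs + size Cs))%N.
Proof.
move=> PAB rA cB Rs Cs uR uC.
have bnd (Q : set nat) s : uniq s ->
    (exists t : seq nat, (size t <= k)%N /\ forall j, Q j -> j \in t) ->
    (\sum_(j <- s) (if `[< Q j >] then 1 else 0) <= k)%N.
  move=> us [t [tk Qt]]; rewrite -big_mkcond sum1_count -size_filter.
  apply: leq_trans tk; apply: uniq_leq_size; first exact: filter_uniq.
  by move=> j; rewrite mem_filter => /andP[/asboolP/Qt].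
apply: leq_trans (count_inU Rs Cs PAB) _; rewrite mulnDr leq_add//.
  rewrite mulnC -sum1_size big_distrl /= leq_sum// => i _; rewrite mul1n.
  exact: (bnd (fun j => A (i, j))).
rewrite /count_in exchange_big /= mulnC -sum1_size big_distrl /= leq_sum// => j _.
by rewrite mul1n; apply: (bnd (fun i => B (i, j))).
Qed.

(** * Truncated sign matrices *)

Lemma sum_cauchy_schwarz (R : realFieldType) (I : finType) (a b : I -> R) :
  (\sum_i a i * b i) ^+ 2 <= (\sum_i a i ^+ 2) * (\sum_i b i ^+ 2).
Proof.
set A := \sum_i a i ^+ 2; set B := \sum_i b i ^+ 2; set D := \sum_i a i * b i.
have B0 : 0 <= B by apply: sumr_ge0 => i _; apply: sqr_ge0.
have [B_eq0|Bn0] := eqVneq B 0.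
  suff -> : D = 0 by rewrite expr0n /= B_eq0 mulr0.
  have /psumr_eq0P b0 := B_eq0.
  apply: big1 => i _; have /eqP := b0 (fun i _ => sqr_ge0 _) i isT.
  by rewrite sqrf_eq0 => /eqP ->; rewrite mulr0.
have Bgt0 : 0 < B by rewrite lt_neqAle eq_sym Bn0.
(* [B a - D b] is [B] times the component of [a] orthogonal to [b]. *)
have : 0 <= \sum_i (B * a i - D * b i) ^+ 2.
  by apply: sumr_ge0 => i _; apply: sqr_ge0.
have -> : \sum_i (B * a i - D * b i) ^+ 2 = B * (A * B - D ^+ 2).
  transitivity (\sum_i (B ^+ 2 * a i ^+ 2 - 2 * B * D * (a i * b i) + D ^+ 2 * b i ^+ 2)).
    by apply: eq_bigr => i _; ring.
  rewrite big_split big_split /= sumrN -!mulr_sumr -/A -/B -/D; ring.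
by rewrite pmulr_rge0// subr_ge0.
Qed.

(** * Resolvent truncation of a matrix to a contraction *)

Section Resolvent.
Variables (R : realType) (n : nat).
Implicit Types (A Y Z : 'M[R]_n) (x w p : 'rV[R]_n).

Definition sqn x : R := \sum_j x 0 j ^+ 2.

Lemma sqnE x : sqn x = (x *m x^T) 0 0.
Proof. by rewrite mxE; apply: eq_bigr => j _; rewrite mxE. Qed.

Lemma sqn_ge0 x : 0 <= sqn x.
Proof. by apply: sumr_ge0 => j _; apply: sqr_ge0. Qed.

Lemma sqnZ a x : sqn (a *: x) = a ^+ 2 * sqn x.
Proof. by rewrite mulr_sumr; apply: eq_bigr => j _; rewrite mxE exprMn. Qed.

Lemma sqn_eq0 x : sqn x = 0 -> x = 0.
Proof.
move=> /psumr_eq0P x0; apply/rowP => j; rewrite mxE; apply/eqP.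
by rewrite -sqrf_eq0 x0// => i _; apply: sqr_ge0.
Qed.

Lemma sqn_polarization a w p :
  sqn (w + a *: p) = sqn (w - a *: p) + 4 * a * (w *m p^T) 0 0.
Proof.
rewrite /sqn mxE mulr_sumr -big_split; apply: eq_bigr => j _ /=.
by rewrite !mxE; ring.
Qed.

(** On singular values, [invmx (gram A) *m A] acts by [t / (1 + t^2 / 4)], which is at most 1 and
    equals 1 at [t = 2]; this fixes the constant 4. *)
Definition gram A : 'M[R]_n := 1%:M + 4^-1 *: (A *m A^T).

Lemma gram_quad A w : (w *m (w *m (A *m A^T))^T) 0 0 = sqn (w *m A).
Proof. by rewrite sqnE !trmx_mul trmxK !mulmxA. Qed.

Lemma mul_gram A w : w *m gram A = w + 4^-1 *: (w *m (A *m A^T)).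
Proof. by rewrite mulmxDr mulmx1 -scalemxAr. Qed.

(** Pairing [w *m gram A = 0] with [w] gives [|w|^2 + |w A|^2 / 4 = 0]. *)
Lemma gram_unit A : gram A \in unitmx.
Proof.
rewrite -row_free_unit -kermx_eq0; apply/rowV0P => w /sub_kermxP.
move=> /(congr1 (fun v => w *m v^T)); rewrite mul_gram => /matrixP/(_ 0 0).
rewrite linearD linearZ /= mulmxDr -scalemxAr trmx0 mulmx0 !mxE.
rewrite -[X in X + _](_ : sqn w = _); last by rewrite sqnE mxE.
rewrite -[X in _ * X](_ : sqn (w *m A) = _); last by rewrite -gram_quad mxE.
by have := sqn_ge0 w; have := sqn_ge0 (w *m A) => h1 h2 h; apply: sqn_eq0; lra.
Qed.

(** For [x = w *m gram A], polarization gives [|x|^2 = |w - w A A^T / 4|^2 + |w A|^2]. *)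
Lemma gram_contraction A x : sqn (x *m (invmx (gram A) *m A)) <= sqn x.
Proof.
set w := x *m invmx (gram A).
have xE : x = w + 4^-1 *: (w *m (A *m A^T)).
  by rewrite -mul_gram mulmxKV ?gram_unit.
rewrite mulmxA -/w [in leRHS]xE sqn_polarization gram_quad mulfV ?pnatr_eq0// mul1r.
by rewrite lerDr sqn_ge0.
Qed.

(** The identity [gram Y^T *m Y^T = Y^T *m gram Y] shows that the transpose of the truncation of [Y]
    is the truncation of [Y^T]. Each claim for rows therefore holds for columns too. *)
Lemma truncation_exists Y : exists Z,
  [/\ forall x, sqn (x *m Z) <= sqn x, forall x, sqn (x *m Z^T) <= sqn x,
      Y - Z = 4^-1 *: (Y *m Y^T *m Z) &
      Y^T - Z^T = 4^-1 *: (Y^T *m Y *m Z^T)].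
Proof.
have gramK A : gram A *m (invmx (gram A) *m A) = A by rewrite mulKVmx ?gram_unit.
have eqn A : A - invmx (gram A) *m A = 4^-1 *: (A *m A^T *m (invmx (gram A) *m A)).
  set Z := invmx (gram A) *m A; rewrite -{1}(gramK A) -/Z mulmxDl mul1mx.
  by rewrite -scalemxAl addrC addKr.
have trE : (invmx (gram Y) *m Y)^T = invmx (gram Y^T) *m Y^T.
  have gramT : (gram Y)^T = gram Y.
    by rewrite linearD linearZ /= trmx1 trmx_mul trmxK.
  rewrite trmx_mul trmx_inv gramT.
  apply: (canRL (mulKmx (gram_unit _))); rewrite mulmxA.
  have -> : gram Y^T *m Y^T = Y^T *m gram Y.
    rewrite /gram trmxK mulmxDl mulmxDr mul1mx mulmx1 -scalemxAl -scalemxAr.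
    by rewrite !mulmxA.
  by rewrite mulmxK ?gram_unit.
exists (invmx (gram Y) *m Y); rewrite trE; split.
- exact: gram_contraction.
- exact: gram_contraction.
- exact: eqn.
- by rewrite eqn trmxK.
Qed.

End Resolvent.

(** * Averages over random signs *)

Definition signed_mx (R : realType) (n : nat) (E : Type)
  (s : E -> 'I_n -> 'I_n -> R) (b : 'M[R]_n) (e : E) : 'M[R]_n :=
  \matrix_(i, j) (s e i j * b i j).

Section SignAverages.
Variables (R : realType) (n : nat) (E : finType) (s : E -> 'I_n -> 'I_n -> R).
Hypothesis s_sqr : forall e i j, s e i j ^+ 2 = 1.
Hypothesis s_orth : forall i i' j j', i != i' -> j != j' ->
  \sum_e (s e i j * s e i' j) * (s e i j' * s e i' j') = 0.
Variable b : 'M[R]_n.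
Hypothesis row_b : forall i, \sum_j b i j ^+ 2 <= 1.
Hypothesis col_b : forall j, \sum_i b i j ^+ 2 <= 1.
Variable Z : E -> 'M[R]_n.
Local Notation Y := (signed_mx s b).
Hypothesis Z_contr : forall e x, sqn (x *m Z e) <= sqn x.
Hypothesis Z_eq : forall e, Y e - Z e = 4^-1 *: (Y e *m (Y e)^T *m Z e).

(** Expanding the square gives a double sum over [j] and [j']; orthogonality kills all terms but
    [j = j'], where every sign is squared. *)
Lemma offdiag_second_moment i i' : i != i' ->
  \sum_e ((Y e *m (Y e)^T) i i') ^+ 2 = #|E|%:R * \sum_j b i j ^+ 2 * b i' j ^+ 2.
Proof.
move=> ii'.
transitivity (\sum_e \sum_j \sum_j' (b i j * b i' j) * (b i j' * b i' j') *
    ((s e i j * s e i' j) * (s e i j' * s e i' j'))).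
  apply: eq_bigr => e _; rewrite mxE expr2 mulr_suml; apply: eq_bigr => j _.
  by rewrite mulr_sumr; apply: eq_bigr => j' _; rewrite !mxE; ring.
rewrite exchange_big mulr_sumr; apply: eq_bigr => j _ /=.
rewrite exchange_big (bigD1 j)//= [X in _ + X]big1 ?addr0.
  rewrite -mulr_sumr (eq_bigr (fun=> 1)) ?sumr_const; last first.
    move=> e _; have <- : s e i j ^+ 2 * s e i' j ^+ 2 = 1 by rewrite !s_sqr mulr1.
    ring.
  by rewrite -mulr_natl mulr1; ring.
by move=> j' jj'; rewrite -mulr_sumr s_orth ?mulr0// eq_sym.
Qed.

(** The diagonal entry is the squared norm of row [i] of [b], hence at most 1. The others sum in
    mean to at most [\sum_j b_ij^2 \sum_i' b_i'j^2], bounded first by the columns and then by row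
    [i]. *)
Lemma fourth_moment i : \sum_e \sum_i' ((Y e *m (Y e)^T) i i') ^+ 2 <= 2 * #|E|%:R.
Proof.
rewrite exchange_big (bigD1 i)//= (_ : 2 * _ = #|E|%:R + #|E|%:R); last by ring.
apply: lerD.
  rewrite -sum1_card natr_sum; apply: ler_sum => e _; rewrite expr_le1//.
    rewrite mxE (eq_bigr (fun j => b i j ^+ 2))// => j _; rewrite !mxE.
    by rewrite -[RHS]mul1r -(s_sqr e i j); ring.
  by rewrite mxE; apply: sumr_ge0 => j _; rewrite !mxE -expr2 sqr_ge0.
rewrite (eq_bigr (fun i' => #|E|%:R * \sum_j b i j ^+ 2 * b i' j ^+ 2)); last first.
  by move=> i' ii'; rewrite offdiag_second_moment// eq_sym.
rewrite -mulr_sumr -[leRHS]mulr1; apply: ler_wpM2l; first exact: ler0n.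
rewrite exchange_big; apply: le_trans (row_b i); apply: ler_sum => j _ /=.
rewrite -mulr_sumr -[leRHS]mulr1; apply: ler_wpM2l; first exact: sqr_ge0.
apply: le_trans (col_b j); rewrite [leRHS](bigID (fun i' => i' != i)) /=.
by rewrite lerDl; apply: sumr_ge0 => k _; apply: sqr_ge0.
Qed.

(** Cauchy-Schwarz moves the square inside the mean over [e]. Row [i] of [Y - Z] is a quarter of row
    [i] of [Y Y^T] followed by the contraction [Z], so the mean is at most [2 / 16]. *)
Lemma truncation_error i :
  \sum_j (#|E|%:R^-1 * \sum_e s e i j * (Y e - Z e) i j) ^+ 2 <= 4^-1.
Proof.
(* Over an empty [E] the convention [0^-1 = 0] makes the average vanish. *)
have [E0|En0] := eqVneq #|E| 0%N.
  rewrite big1 ?invr_ge0// => j _.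
  by rewrite E0 invr0 mul0r expr0n.
have c0 : 0 < #|E|%:R :> R by rewrite ltr0n lt0n.
have Jensen j : (#|E|%:R^-1 * \sum_e s e i j * (Y e - Z e) i j) ^+ 2 <=
    #|E|%:R^-1 * \sum_e ((Y e - Z e) i j) ^+ 2.
  have := sum_cauchy_schwarz (fun e => s e i j) (fun e => (Y e - Z e) i j).
  have -> : \sum_e s e i j ^+ 2 = #|E|%:R.
    by rewrite -sum1_card natr_sum; apply: eq_bigr => e _.
  move=> h; rewrite exprMn expr2 -mulrA ler_pM2l ?invr_gt0// ler_pdivrMl//.
apply: le_trans (ler_sum _ (fun j _ => Jensen j)) _.
rewrite -mulr_sumr exchange_big /=.
have rowE e : \sum_j ((Y e - Z e) i j) ^+ 2 <=
    16^-1 * \sum_i' ((Y e *m (Y e)^T) i i') ^+ 2.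
  have -> : \sum_j ((Y e - Z e) i j) ^+ 2 = sqn (row i (Y e - Z e)).
    by apply: eq_bigr => j _; rewrite [in RHS]mxE.
  rewrite Z_eq linearZ /= row_mul sqnZ.
  have -> : \sum_i' ((Y e *m (Y e)^T) i i') ^+ 2 = sqn (row i (Y e *m (Y e)^T)).
    by apply: eq_bigr => j _; rewrite [in RHS]mxE.
  have := Z_contr e (row i (Y e *m (Y e)^T)).
  have := sqn_ge0 (row i (Y e *m (Y e)^T)) => h1 h2.
  have -> : (4^-1 : R) ^+ 2 = 16^-1 by field.
  by apply: ler_wpM2l => //; rewrite invr_ge0 ler0n.
rewrite mulrC ler_pdivrMr//.
apply: le_trans (ler_sum _ (fun e _ => rowE e)) _; rewrite -mulr_sumr.
have := fourth_moment i; lra.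
Qed.

End SignAverages.

Section Signs.
Variables (R : realType) (n : nat).
Definition signs : finType := {ffun 'I_n * 'I_n -> bool}.
Definition sg (e : signs) (i j : 'I_n) : R := (-1) ^+ e (i, j).

Lemma sg_sqr e i j : sg e i j ^+ 2 = 1.
Proof. by rewrite /sg -exprM mulnC exprM sqrrN !expr1n. Qed.

(** The sign at [(i, j)] occurs exactly once in each summand, so flipping it negates the sum. *)
Lemma sg_orth i i' j j' : i != i' -> j != j' ->
  \sum_e (sg e i j * sg e i' j) * (sg e i j' * sg e i' j') = 0.
Proof.
move=> ii' jj'.
pose flip (e : signs) : signs := [ffun p => e p (+) (p == (i, j))].
have flipK : involutive flip.
  by move=> e; apply/ffunP => p; rewrite !ffunE -addbA addbb addbF.
set S := LHS.
have : S = - S.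
  rewrite {1}/S (reindex_inj (inv_inj flipK)) -sumrN; apply: eq_bigr => e _ /=.
  have sgflip k l : sg (flip e) k l = (if (k, l) == (i, j) then -1 else 1) * sg e k l.
    rewrite /sg ffunE; case: eqP => _; rewrite ?addbT ?addbF ?mul1r//.
    by case: (e _); rewrite /= ?expr0 ?expr1; ring.
  rewrite !sgflip !xpair_eqE !eqxx /= (eq_sym i') (negPf ii') (eq_sym j').
  by rewrite (negPf jj') /=; ring.
by move: S => S SS; lra.
Qed.

End Signs.

Section SignSelection.
Variables (R : realType) (n : nat) (w : 'M[R]_n).

Definition l2ball : set 'M[R]_n :=
  [set b | (forall i, \sum_j b i j ^+ 2 <= 1) /\ (forall j, \sum_i b i j ^+ 2 <= 1)].

Definition pairing (b : 'M[R]_n) : R := \sum_i \sum_j w i j * b i j.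

Lemma pairingZ a b : pairing (a *: b) = a * pairing b.
Proof.
rewrite mulr_sumr; apply: eq_bigr => i _; rewrite mulr_sumr.
by apply: eq_bigr => j _; rewrite mxE; ring.
Qed.


(* The functional is evaluated at a near-maximiser [b] of the ball, so that the
   truncation error, which lies in half the ball, costs at most half of it. *)
Lemma sign_selection (b0 : 'M[R]_n) (t : R) : 0 < t -> l2ball b0 -> t <= pairing b0 ->
  exists (e : signs n) (Z : 'M[R]_n), (forall x, sqn (x *m Z^T) <= sqn x) /\
    t / 4 <= \sum_i \sum_j w i j * (sg R e i j * Z i j).
Proof.
move=> t0 b0B tb0; pose S := [set pairing b | b in l2ball].
have S_ub : has_ubound S.
  exists (\sum_i \sum_j `|w i j|) => _ [b [rb _] <-].
  apply: ler_sum => i _; apply: ler_sum => j _.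
  apply: le_trans (ler_norm _) _; rewrite normrM -[leRHS]mulr1.
  apply: ler_wpM2l => //; rewrite -(@expr_le1 _ 2)// real_normK ?num_real//.
  apply: le_trans (rb i); rewrite (bigD1 j)//= lerDl.
  by apply: sumr_ge0 => k _; apply: sqr_ge0.
have S_sup : has_sup S by split=> //; exists (pairing b0), b0.
pose M := sup S.
have leM b : l2ball b -> pairing b <= M by move=> bB; apply: ub_le_sup => //; exists b.
have tM : t <= M := le_trans tb0 (leM _ b0B).
have M4 : 0 < M / 4 by lra.
(* With slack [M / 4], [pairing b] exceeds [3 M / 4]; the error costs at most [M / 2], which leaves
   a mean above [M / 4 >= t / 4]. *)
have [_ [b [rb cb] <-] Mb] := sup_adherent M4 S_sup; rewrite -/M in Mb.
pose Y := signed_mx (@sg R n) b.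
have [Z HZ] := choice (fun e => truncation_exists (Y e)).
pose k : R := #|signs n|%:R.
have k0 : 0 < k by rewrite ltr0n; apply/card_gt0P; exists [ffun=> true].
pose d : 'M[R]_n := \matrix_(i, j) (k^-1 * \sum_e sg R e i j * (Y e - Z e) i j).
have dM : 2 * pairing d <= M.
  rewrite -pairingZ; apply: leM; split=> [i|j].
    rewrite (eq_bigr (fun j => 4 * (k^-1 * \sum_e sg R e i j * (Y e - Z e) i j) ^+ 2)).
      have E4 e x : sqn (x *m Z e) <= sqn x by case: (HZ e).
      have E5 e : Y e - Z e = 4^-1 *: (Y e *m (Y e)^T *m Z e) by case: (HZ e).
      have := truncation_error (@sg_sqr R n) (@sg_orth R n) rb cb E4 E5 i.
      by rewrite -/k -/Y -mulr_sumr; lra.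
    by move=> j _; rewrite !mxE; ring.
  (* The column condition is the row estimate applied to the transposes of the signs, of [b] and of
     [Z]. *)
  rewrite (eq_bigr (fun i => 4 * (k^-1 * \sum_e sg R e i j * (Y e - Z e) i j) ^+ 2)).
    pose s (e : signs n) i j := sg R e j i.
    have YT e : signed_mx s b^T e = (Y e)^T by apply/matrixP => i l; rewrite !mxE.
    have E0 e i l : s e i l ^+ 2 = 1 by apply: sg_sqr.
    have E1 (i i' l l' : 'I_n) : i != i' -> l != l' ->
        \sum_e s e i l * s e i' l * (s e i l' * s e i' l') = 0.
      move=> ii' ll'; rewrite -[RHS](sg_orth R ll' ii').
      by apply: eq_bigr => e _; rewrite /s; ring.
    have E2 i : \sum_j b^T i j ^+ 2 <= 1.
      by apply: le_trans (cb i); apply: ler_sum => l _; rewrite mxE.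
    have E3 i : \sum_j b^T j i ^+ 2 <= 1.
      by apply: le_trans (rb i); apply: ler_sum => l _; rewrite mxE.
    have E4 e x : sqn (x *m (Z e)^T) <= sqn x by case: (HZ e).
    have E5 e : signed_mx s b^T e - (Z e)^T =
        4^-1 *: (signed_mx s b^T e *m (signed_mx s b^T e)^T *m (Z e)^T).
      by rewrite YT trmxK; case: (HZ e).
    have H := truncation_error E0 E1 E2 E3 E4 E5 j.
    rewrite -mulr_sumr; apply: (@le_trans _ _ (4 * 4^-1)); last by lra.
    apply: ler_wpM2l => //; apply: le_trans H; apply: ler_sum => i _.
    rewrite le_eqVlt; apply/orP; left; apply/eqP; congr ((_ * _) ^+ 2).
    by apply: eq_bigr => e _; rewrite YT !mxE.
  by move=> i _; rewrite !mxE; ring.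
apply: contrapT => nex.
have small e : \sum_i \sum_j w i j * (sg R e i j * Z e i j) <= t / 4.
  rewrite leNgt; apply/negP => lt; apply: nex; exists e, (Z e); split; last exact: ltW.
  by case: (HZ e).
have bE : pairing b = k^-1 * (\sum_e \sum_i \sum_j w i j * (sg R e i j * Z e i j)) +
    pairing d.
  rewrite exchange_big mulr_sumr -big_split; apply: eq_bigr => i _ /=.
  rewrite exchange_big mulr_sumr -big_split; apply: eq_bigr => j _ /=.
  rewrite -mulr_sumr mulrCA -mulrDr mxE -mulrDr -big_split /=; congr (_ * _).
  rewrite (eq_bigr (fun=> b i j)) ?sumr_const => [|e _].
    by rewrite -[_ *+ _]mulr_natl mulKf ?gt_eqF.
  by rewrite !mxE -[RHS]mul1r -(sg_sqr R e i j); ring.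
have : k^-1 * (\sum_e \sum_i \sum_j w i j * (sg R e i j * Z e i j)) <= t / 4.
  rewrite mulrC ler_pdivrMr// mulrC; apply: le_trans (ler_sum _ (fun e _ => small e)) _.
  by rewrite sumr_const -[leLHS]mulr_natl.
lra.
Qed.

End SignSelection.

(** On each of the [q] positions the summand is [sqrt (min (d_i, d'_j)) / q], at least [sqrt m / q].
    Dividing by the larger degree keeps both row and column norms of [b] at most 1. The support
    clauses let a multiplier be arbitrary off the lines that meet [Q]. *)
Lemma degree_pairing (R : realType) (n m : nat) (Q : 'I_n -> 'I_n -> bool) :
  (0 < m)%N -> (exists i j, Q i j) ->
  (forall i j, Q i j -> (m <= \sum_j' Q i j')%N /\ (m <= \sum_i' Q i' j)%N) ->
  exists (u v : 'I_n -> R) (b : 'M[R]_n),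
    [/\ \sum_i u i ^+ 2 = 1, \sum_j v j ^+ 2 = 1,
        (forall i, u i != 0 -> exists j, Q i j) /\
        (forall j, v j != 0 -> exists i, Q i j),
        l2ball b &
        Num.sqrt m%:R <= pairing (\matrix_(i, j) ((Q i j)%:R * (u i * v j))) b].
Proof.
move=> m0 [i0 [j0 Q0]] degQ.
pose dr i : R := (\sum_j Q i j)%N%:R; pose dc j : R := (\sum_i Q i j)%N%:R.
pose q : R := (\sum_i \sum_j Q i j)%N%:R.
have dr0 i : 0 <= dr i by apply: ler0n.
have dc0 j : 0 <= dc j by apply: ler0n.
have q0 : 0 < q.
  rewrite ltr0n (bigD1 i0)//= (bigD1 j0)//= Q0; lia.
have mR : 0 < m%:R :> R by rewrite ltr0n.
exists (fun i => Num.sqrt (dr i / q)), (fun j => Num.sqrt (dc j / q)).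
exists (\matrix_(i, j) ((Q i j)%:R / Num.sqrt (Num.max (dr i) (dc j)))).
have rowneq0 i : dr i != 0 -> exists j, Q i j.
  move=> di; apply: contrapT => nQ; move/eqP: di; apply; rewrite /dr big1// => j _.
  by apply/eqP; rewrite eqb0; apply/negP => Qij; apply: nQ; exists j.
have colneq0 j : dc j != 0 -> exists i, Q i j.
  move=> di; apply: contrapT => nQ; move/eqP: di; apply; rewrite /dc big1// => i _.
  by apply/eqP; rewrite eqb0; apply/negP => Qij; apply: nQ; exists i.
have sqQ i j : (Q i j)%:R ^+ 2 = (Q i j)%:R :> R.
  by case: (Q i j); rewrite ?expr1n ?expr0n.
split.
- rewrite (eq_bigr (fun i => dr i / q)); last first.
    by move=> i _; rewrite sqr_sqrtr// divr_ge0// ltW.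
  by rewrite -mulr_suml /dr -natr_sum mulfV ?gt_eqF.
- rewrite (eq_bigr (fun i => dc i / q)); last first.
    by move=> i _; rewrite sqr_sqrtr// divr_ge0// ltW.
  by rewrite -mulr_suml /dc -natr_sum exchange_big mulfV ?gt_eqF.
- by split=> i; rewrite sqrtr_eq0 -ltNge => h; [apply: rowneq0|apply: colneq0];
    apply: contraTneq h => ->; rewrite mul0r ltxx.
- split=> [i|j].
    rewrite (eq_bigr (fun j => (Q i j)%:R / Num.max (dr i) (dc j))); last first.
      by move=> j _; rewrite mxE expr_div_n sqQ sqr_sqrtr// le_max dr0.
    have [d0|dn0] := eqVneq (dr i) 0.
      rewrite big1 ?ler01// => j _; case Qij: (Q i j); last by rewrite mul0r.
      by have [] := degQ i j Qij; move: d0 => /eqP; rewrite pnatr_eq0 => /eqP->; lia.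
    apply: (@le_trans _ _ (\sum_j (Q i j)%:R / dr i)).
      apply: ler_sum => j _; apply: ler_wpM2l; first exact: ler0n.
      have dgt : 0 < dr i by rewrite lt_neqAle eq_sym dn0 dr0.
      by rewrite lef_pV2 ?le_max ?lexx// posrE ?lt_max dgt.
    by rewrite -mulr_suml -natr_sum mulfV.
  rewrite (eq_bigr (fun i => (Q i j)%:R / Num.max (dr i) (dc j))); last first.
    by move=> i _; rewrite mxE expr_div_n sqQ sqr_sqrtr// le_max dr0.
  have [d0|dn0] := eqVneq (dc j) 0.
    rewrite big1 ?ler01// => i _; case Qij: (Q i j); last by rewrite mul0r.
    by have [_] := degQ i j Qij; move: d0 => /eqP; rewrite pnatr_eq0 => /eqP->; lia.
  apply: (@le_trans _ _ (\sum_i (Q i j)%:R / dc j)).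
    apply: ler_sum => i _; apply: ler_wpM2l; first exact: ler0n.
    have dgt : 0 < dc j by rewrite lt_neqAle eq_sym dn0 dc0.
    by rewrite lef_pV2 ?le_max ?lexx ?orbT// posrE ?lt_max dgt ?orbT.
  by rewrite -mulr_suml -natr_sum mulfV.
- have -> : Num.sqrt m%:R = \sum_i \sum_j (Q i j)%:R * (Num.sqrt m%:R / q).
    rewrite (eq_bigr (fun i => dr i * (Num.sqrt m%:R / q))).
      by rewrite -mulr_suml /dr -natr_sum -/q mulrCA mulfV ?mulr1 ?gt_eqF.
    by move=> i _; rewrite -mulr_suml -natr_sum.
  apply: ler_sum => i _; apply: ler_sum => j _; rewrite !mxE.
  case Qij: (Q i j); last by rewrite !mul0r.
  have [] := degQ i j Qij; rewrite -(ler_nat R) -/(dr i) => md.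
  rewrite -(ler_nat R) -/(dc j) => mc.
  set X := Num.max _ _.
  have X0 : 0 < X by rewrite lt_max (lt_le_trans mR md).
  have mX : m%:R * X <= dr i * dc j by rewrite /X; case: (leP (dr i)) => _; nra.
  rewrite !mul1r -sqrtrM ?divr_ge0 ?(ltW q0)//.
  have -> : dr i / q * (dc j / q) = dr i * dc j * q^-1 ^+ 2 by ring.
  rewrite sqrtrM ?mulr_ge0// sqrtr_sqr ger0_norm ?invr_ge0 ?(ltW q0)//.
  rewrite ler_pdivlMr ?sqrtr_gt0// mulrAC -sqrtrM ?(ltW mR)//.
  by apply: ler_wpM2r; [rewrite invr_ge0 ltW|apply: ler_wsqrtr].
Qed.

(** * Dense cores of patterns *)

Lemma count_in_remrow P i Rs Cs : i \in Rs -> count_in P Rs Cs =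
  (\sum_(j <- Cs) (if `[< P (i, j) >] then 1 else 0) + count_in P (rem i Rs) Cs)%N.
Proof. by move=> iR; rewrite /count_in (big_rem i). Qed.

Lemma count_in_remcol P j Rs Cs : j \in Cs -> count_in P Rs Cs =
  (\sum_(i <- Rs) (if `[< P (i, j) >] then 1 else 0) + count_in P Rs (rem j Cs))%N.
Proof.
move=> jC; rewrite /count_in exchange_big (big_rem j)//=.
by congr addn; rewrite exchange_big.
Qed.

(* Deleting a line of degree at most [h] preserves the density violation. *)
Lemma dense_core_seq P h Rs Cs : uniq Rs -> uniq Cs ->
  (h * (size Rs + size Cs) < count_in P Rs Cs)%N ->
  exists Rs' Cs', [/\ uniq Rs', uniq Cs', (0 < count_in P Rs' Cs')%N,
    forall i, i \in Rs' -> (h < \sum_(j <- Cs') (if `[< P (i, j) >] then 1 else 0))%N &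
    forall j, j \in Cs' -> (h < \sum_(i <- Rs') (if `[< P (i, j) >] then 1 else 0))%N].
Proof.
have drop a b c d : (b <= a -> a + c < b + d -> c < d)%N by lia.
have [k] := ubnP (size Rs + size Cs); elim: k Rs Cs => // k IH Rs Cs szk uR uC dens.
have [rowok|/existsNP[i /not_implyP[iR /negP]]] := pselect (forall i, i \in Rs ->
    (h < \sum_(j <- Cs) (if `[< P (i, j) >] then 1 else 0))%N); last first.
  rewrite -leqNgt => degi; apply: (IH (rem i Rs) Cs); rewrite ?rem_uniq ?size_rem//.
    by case: Rs iR szk {uR dens IH} => //= a l _; lia.
  have R0 : (0 < size Rs)%N by case: Rs iR {szk uR IH dens degi}.
  move: dens; rewrite (count_in_remrow _ _ iR).
  have -> : (size Rs + size Cs = ((size Rs).-1 + size Cs).+1)%N by lia.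
  by rewrite mulnS; apply: drop.
have [colok|/existsNP[j /not_implyP[jC /negP]]] := pselect (forall j, j \in Cs ->
    (h < \sum_(i <- Rs) (if `[< P (i, j) >] then 1 else 0))%N); last first.
  rewrite -leqNgt => degj; apply: (IH Rs (rem j Cs)); rewrite ?rem_uniq ?size_rem//.
    by case: Cs jC szk {uC dens IH rowok} => //= a l _; lia.
  have C0 : (0 < size Cs)%N by case: Cs jC {szk uC IH rowok dens degj}.
  move: dens; rewrite (count_in_remcol _ _ jC).
  have -> : (size Rs + size Cs = (size Rs + (size Cs).-1).+1)%N by lia.
  by rewrite mulnS; apply: drop.
by exists Rs, Cs; split=> //; apply: leq_ltn_trans dens.
Qed.

Lemma sum_seq_ord n (s : seq nat) (F : nat -> nat) : uniq s ->
  (forall i, i \in s -> (i < n)%N) ->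
  (\sum_(i <- s) F i = \sum_(i < n) if val i \in s then F i else 0)%N.
Proof.
move=> us sn; rewrite -big_mkcond -(big_mkord (mem s) F) -[RHS]big_filter.
apply: perm_big; apply: uniq_perm => //; first by rewrite filter_uniq ?iota_uniq.
move=> i; rewrite mem_filter /= mem_index_iota /=.
by case iS: (i \in s) => //=; rewrite sn.
Qed.

Lemma dense_core P h Rs Cs : uniq Rs -> uniq Cs ->
  (h * (size Rs + size Cs) < count_in P Rs Cs)%N ->
  exists (n : nat) (Q : 'I_n -> 'I_n -> bool),
    [/\ exists i j, Q i j, forall i j : 'I_n, Q i j -> P (i : nat, j : nat) &
        forall i j, Q i j -> (h < \sum_j' Q i j')%N /\ (h < \sum_i' Q i' j)%N].
Proof.
move=> uR uC /(dense_core_seq uR uC)[{uR uC}R [C [uR uC pos degR degC]]].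
(* One range for rows and columns alike, since the truncation works with square matrices. *)
pose n := (\max_(i <- R ++ C) i).+1.
have ltn i : i \in R ++ C -> (i < n)%N.
  by move=> iRC; rewrite ltnS; apply: (@leq_bigmax_seq _ _ xpredT id).
have ltR i : i \in R -> (i < n)%N by move=> iR; apply: ltn; rewrite mem_cat iR.
have ltC i : i \in C -> (i < n)%N by move=> iC; apply: ltn; rewrite mem_cat iC orbT.
pose Q (i j : 'I_n) := [&& val i \in R, val j \in C & `[< P (val i, val j) >]].
exists n, Q; split.
- apply: contrapT => nQ; move: pos; rewrite lt0n => /eqP; apply.
  rewrite /count_in big_seq big1// => i iR; rewrite big_seq big1// => j jC.
  case: asboolP => // Pij; exfalso; apply: nQ.
  exists (Ordinal (ltR i iR)), (Ordinal (ltC j jC)).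
  by rewrite /Q /= iR jC; apply/asboolP.
- by move=> i j /and3P[_ _ /asboolP].
- move=> i j /and3P[iR jC _]; split.
    apply: leq_trans (degR _ iR) _; rewrite (sum_seq_ord _ uC ltC) leq_sum// => j' _.
    by rewrite /Q iR /=; case: (_ \in C); case: `[< _ >].
  apply: leq_trans (degC _ jC) _; rewrite (sum_seq_ord _ uR ltR) leq_sum// => i' _.
  by rewrite /Q jC /=; case: (_ \in R); case: `[< _ >].
Qed.

(** What is left for further diagonal blocks once the first [N] rows and columns are taken. *)
Definition tail_pattern (P : pattern) (N : nat) : pattern :=
  [set e | [/\ P e, (N <= e.1)%N & (N <= e.2)%N]].

(* The first [N] rows and columns only contribute [N (|R| + |C|)]. *)
Lemma count_in_tail P N h Rs Cs : uniq Rs -> uniq Cs ->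
  ((h + N) * (size Rs + size Cs) < count_in P Rs Cs)%N ->
  (h * (size Rs + size Cs) < count_in (tail_pattern P N) Rs Cs)%N.
Proof.
move=> uR uC; set D : pattern := [set e | (e.1 < N)%N] `|` [set e | (e.2 < N)%N].
have PD : P `<=` tail_pattern P N `|` D.
  move=> e Pe; case: (leqP N e.1) => e1; last by right; left.
  by case: (leqP N e.2) => e2; [left|right; right].
have DN : (count_in D Rs Cs <= N * (size Rs + size Cs))%N.
  apply: (@count_in_decomposition [set e | (e.2 < N)%N] [set e | (e.1 < N)%N]) => //.
  - by move=> e []; [right|left].
  - by move=> i; exists (iota 0 N); rewrite size_iota; split=> // j; rewrite mem_iota.
  - by move=> i; exists (iota 0 N); rewrite size_iota; split=> // j; rewrite mem_iota.
have := count_inU Rs Cs PD; rewrite mulnDl; lia.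
Qed.

Section Density.
Variable R : realType.

Lemma density_leP (P : pattern) (m : nat) :
  (density_sup R P <= (m%:R)%:E)%E <->
  forall Rs Cs, uniq Rs -> uniq Cs -> (count_in P Rs Cs <= m * (size Rs + size Cs))%N.
Proof.
split=> [dm Rs Cs uR uC|dens].
  have [sz0|sz0] := posnP (size Rs + size Cs).
    have /size0nil -> : size Rs = 0%N by lia.
    by rewrite /count_in big_nil.
  have : (((count_in P Rs Cs)%:R / (size Rs + size Cs)%:R)%:E <= (m%:R)%:E :> \bar R)%E.
    by apply: le_trans dm; apply: ereal_sup_ubound; exists Rs, Cs.
  by rewrite lee_fin ler_pdivrMr ?ltr0n// -natrM ler_nat.
apply: ge_ereal_sup => _ [Rs [Cs [uR uC sz0 ->]]].
by rewrite lee_fin ler_pdivrMr ?ltr0n// -natrM ler_nat dens.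
Qed.

Lemma not_density_le (P : pattern) (m : nat) :
  ~ (density_sup R P <= (m%:R)%:E)%E ->
  exists Rs Cs, [/\ uniq Rs, uniq Cs &
    (m * (size Rs + size Cs) < count_in P Rs Cs)%N].
Proof.
move=> nd; apply: contrapT => nex; apply/nd/density_leP => Rs Cs uR uC.
by rewrite leqNgt; apply/negP => lt; apply: nex; exists Rs, Cs.
Qed.

Lemma ltyP_nat (x : \bar R) : (x < +oo)%E <-> exists m : nat, (x <= (m%:R)%:E)%E.
Proof.
split=> [|[m xm]]; last exact: le_lt_trans xm (ltry _).
case: x => [r _| //|_]; last by exists 0%N; rewrite leNye.
exists (Num.bound `|r|); rewrite lee_fin.
by apply: le_trans (ler_norm _) _; apply/ltW/archi_boundP/normr_ge0.
Qed.

End Density.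

(** * Upper bound for Schur multipliers *)

Section ComplexForms.
Local Open Scope complex_scope.
Variable R : realType.
Local Notation C := R[i].
Local Notation normc := (@Normc.normc R).
Implicit Types (T X : mat R) (x y : nat -> C).

Lemma normc_ge0 (z : C) : 0 <= normc z.
Proof. by case: z => a b; apply: sqrtr_ge0. Qed.

Lemma normc_sqr (z : C) : normc z ^+ 2 = complex.Re z ^+ 2 + complex.Im z ^+ 2.
Proof. by case: z => a b; rewrite /= sqr_sqrtr// addr_ge0 ?sqr_ge0. Qed.

Lemma normc_real (r : R) : normc r%:C = `|r|.
Proof. by rewrite /= expr0n addr0 sqrtr_sqr. Qed.

Lemma normc_conj (z : C) : normc (conjc z) = normc z.
Proof. by case: z => a b; rewrite /= sqrrN. Qed.

Lemma conjcM (z w : C) : conjc (z * w) = conjc z * conjc w.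
Proof. exact: rmorphM. Qed.

Lemma conjcR (r : R) : conjc r%:C = r%:C.
Proof. exact: conjc_real. Qed.

Lemma realcM (a b : R) : (a * b)%:C = a%:C * b%:C.
Proof. exact: rmorphM. Qed.

Lemma normc_sum (I : finType) (F : I -> C) : normc (\sum_i F i) <= \sum_i normc (F i).
Proof.
elim/big_ind2: _ => [|a b c d ab cd|i _]//; first by rewrite Normc.normc0.
exact: le_trans (le_normcD _ _) (lerD ab cd).
Qed.

Lemma l2sq_ge0 n x : 0 <= l2sq n x.
Proof. by apply: sumr_ge0 => i _; apply: sqr_ge0. Qed.

Lemma l2sqZ n (a : R) x : l2sq n (fun i => a%:C * x i) = a ^+ 2 * l2sq n x.
Proof.
rewrite /l2sq mulr_sumr; apply: eq_bigr => i _.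
by rewrite Normc.normcM normc_real exprMn real_normK ?num_real.
Qed.

Lemma l2sq_eq0 n x (i : 'I_n) : l2sq n x = 0 -> x i = 0.
Proof.
move=> /psumr_eq0P x0; have /eqP := x0 (fun i _ => sqr_ge0 _) i isT.
by rewrite sqrf_eq0 => /eqP/Normc.eq0_normc.
Qed.

Lemma bilinZ T n (a b : R) x y :
  bilin T n (fun i => a%:C * x i) (fun i => b%:C * y i) = (a * b)%:C * bilin T n x y.
Proof.
rewrite mulr_sumr; apply: eq_bigr => i _; rewrite mulr_sumr; apply: eq_bigr => j _.
by rewrite conjcM conjcR realcM; ring.
Qed.

(** By homogeneity one may normalise [x] and [y]; a zero vector cannot be normalised, but then the
    form vanishes. *)
Lemma opnorm_bilin T n x y : (opnorm T <= 1%:E)%E ->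
  normc (bilin T n x y) <= Num.sqrt (l2sq n x) * Num.sqrt (l2sq n y).
Proof.
move=> T1.
have [x0|xn0] := eqVneq (l2sq n x) 0.
  rewrite x0 sqrtr0 mul0r /bilin big1 ?Normc.normc0// => i _; rewrite big1// => j _.
  by rewrite (l2sq_eq0 j x0) mulr0.
have [y0|yn0] := eqVneq (l2sq n y) 0.
  rewrite y0 sqrtr0 mulr0 /bilin big1 ?Normc.normc0// => i _; rewrite big1// => j _.
  by rewrite (l2sq_eq0 i y0) conjc0 !mul0r.
set a := Num.sqrt _; set b := Num.sqrt _.
have a0 : 0 < a by rewrite sqrtr_gt0 lt_neqAle eq_sym xn0 l2sq_ge0.
have b0 : 0 < b by rewrite sqrtr_gt0 lt_neqAle eq_sym yn0 l2sq_ge0.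
have : ((normc (bilin T n (fun i => a^-1%:C * x i) (fun i => b^-1%:C * y i)))%:E
    <= 1%:E)%E.
  apply: le_trans T1; apply: ereal_sup_ubound.
  exists n, (fun i => a^-1%:C * x i), (fun i => b^-1%:C * y i); split=> //.
    by rewrite l2sqZ exprVn sqr_sqrtr ?l2sq_ge0// mulVf.
  by rewrite l2sqZ exprVn sqr_sqrtr ?l2sq_ge0// mulVf.
rewrite bilinZ lee_fin Normc.normcM normc_real ger0_norm.
  by rewrite -invfM mulrC ler_pdivrMr ?mulr_gt0// mul1r.
by rewrite mulr_ge0// invr_ge0 ltW.
Qed.

Lemma sum_mem_le (n k : nat) (s : seq nat) (a : nat -> R) : (size s <= k)%N ->
  (forall j, 0 <= a j <= 1) -> (forall j, a j != 0 -> j \in s) ->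
  \sum_(j < n) a j <= k%:R.
Proof.
move=> sk a1 as_; apply: (@le_trans _ _ (\sum_(j < n) (val j \in s : nat)%:R)).
  apply: ler_sum => j _; have [->|/as_ ->] := eqVneq (a j) 0; first exact: ler0n.
  by case/andP: (a1 j).
rewrite -natr_sum ler_nat; apply: leq_trans sk.
rewrite -(big_mkord xpredT (fun j => (j \in s : nat))) -big_mkcond sum1_count.
rewrite -size_filter; apply: uniq_leq_size; first by rewrite filter_uniq ?iota_uniq.
by move=> j; rewrite mem_filter => /andP[].
Qed.

Lemma sqrt_cauchy_schwarz n (k : R) (a S c : 'I_n -> R) :
  (forall i, 0 <= S i) -> \sum_i a i ^+ 2 <= 1 -> \sum_i S i <= k ->
  (forall i, c i <= a i * Num.sqrt (S i)) -> \sum_i c i <= Num.sqrt k.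
Proof.
move=> S0 a1 Sk ca; apply: le_trans (ler_sum _ (fun i _ => ca i)) _.
apply: le_trans (ler_norm _) _; rewrite -sqrtr_sqr; apply: ler_wsqrtr.
apply: le_trans (sum_cauchy_schwarz _ _) _.
rewrite (eq_bigr S (fun i _ => sqr_sqrtr (S0 i))); apply: le_trans Sk.
by rewrite -[leRHS]mul1r; apply: ler_wpM2r => //; apply: sumr_ge0.
Qed.

(** Column [j] of [X] is absorbed into [y], conjugated because [bilin] conjugates that argument.
    Each [y_i] is then used with total weight [\sum_j |X_ij|^2 <= k]. *)
Lemma schur_row_bound X T (A : pattern) k n x y : SP A X -> row_bounded_by k A ->
  (opnorm T <= 1%:E)%E -> l2sq n x <= 1 -> l2sq n y <= 1 ->
  normc (bilin (schur X T) n x y) <= Num.sqrt k%:R.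
Proof.
move=> [XA X1] rA T1 x1 y1.
have -> : bilin (schur X T) n x y = \sum_(j < n)
    bilin T n (fun l => if l == j :> nat then x j else 0) (fun i => conjc (X i j) * y i).
  rewrite /bilin exchange_big; apply: eq_bigr => j _; apply: eq_bigr => i _ /=.
  rewrite (bigD1 j)//= eqxx big1 ?addr0 => [|l /negPf lj].
    by rewrite conjcM conjcK /schur; ring.
  by rewrite -val_eqE in lj; rewrite lj mulr0.
apply: le_trans (normc_sum _) _.
pose S (j : 'I_n) := \sum_(i < n) normc (X i j) ^+ 2 * normc (y i) ^+ 2.
apply: (@sqrt_cauchy_schwarz n _ (fun j => normc (x j)) S) => // [j||j].
- by apply: sumr_ge0 => i _; rewrite mulr_ge0 ?sqr_ge0.
- rewrite exchange_big /=; apply: le_trans (_ : k%:R * l2sq n y <= _); last first.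
    by rewrite -[leRHS]mulr1; apply: ler_wpM2l => //; apply: ler0n.
  rewrite mulr_sumr; apply: ler_sum => i _; rewrite -mulr_suml.
  apply: ler_wpM2r; first exact: sqr_ge0.
  have [s [sk As]] := rA i; apply: (sum_mem_le n sk (a := fun j => normc (X i j) ^+ 2)).
    by move=> j; rewrite sqr_ge0 expr_le1 ?normc_ge0 ?X1.
  move=> j nz; apply/As/XA; apply: contraNneq nz => ->.
  by rewrite Normc.normc0 expr0n.
- apply: le_trans (opnorm_bilin _ _ _ T1) _; rewrite (_ : l2sq n _ = normc (x j) ^+ 2).
    rewrite sqrtr_sqr ger0_norm ?normc_ge0//; apply: ler_wpM2l; first exact: normc_ge0.
    apply: ler_wsqrtr; apply: ler_sum => i _.
    by rewrite Normc.normcM normc_conj exprMn.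
  rewrite /l2sq (bigD1 j)//= eqxx big1 ?addr0// => l /negPf lj.
  by rewrite -val_eqE in lj; rewrite lj Normc.normc0 expr0n.
Qed.

(** The mirror argument: row [i] of [X] is absorbed into [x], with weights summed down the
    columns. *)
Lemma schur_col_bound X T (A : pattern) k n x y : SP A X -> col_bounded_by k A ->
  (opnorm T <= 1%:E)%E -> l2sq n x <= 1 -> l2sq n y <= 1 ->
  normc (bilin (schur X T) n x y) <= Num.sqrt k%:R.
Proof.
move=> [XA X1] cA T1 x1 y1.
have -> : bilin (schur X T) n x y = \sum_(i < n)
    bilin T n (fun j => X i j * x j) (fun l => if l == i :> nat then y i else 0).
  apply: eq_bigr => i _; rewrite /bilin [RHS](bigD1 i)//= eqxx [X in _ + X]big1 ?addr0.
    by apply: eq_bigr => j _; rewrite /schur; ring.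
  move=> l /negPf li; rewrite -val_eqE in li; rewrite big1// => j _.
  by rewrite li conjc0 !mul0r.
apply: le_trans (normc_sum _) _.
pose S (i : 'I_n) := \sum_(j < n) normc (X i j) ^+ 2 * normc (x j) ^+ 2.
apply: (@sqrt_cauchy_schwarz n _ (fun i => normc (y i)) S) => // [i||i].
- by apply: sumr_ge0 => j _; rewrite mulr_ge0 ?sqr_ge0.
- rewrite exchange_big /=; apply: le_trans (_ : k%:R * l2sq n x <= _); last first.
    by rewrite -[leRHS]mulr1; apply: ler_wpM2l => //; apply: ler0n.
  rewrite mulr_sumr; apply: ler_sum => j _; rewrite -mulr_suml.
  apply: ler_wpM2r; first exact: sqr_ge0.
  have [s [sk As]] := cA j; apply: (sum_mem_le n sk (a := fun i => normc (X i j) ^+ 2)).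
    by move=> i; rewrite sqr_ge0 expr_le1 ?normc_ge0 ?X1.
  move=> i nz; apply/As/XA; apply: contraNneq nz => ->.
  by rewrite Normc.normc0 expr0n.
- apply: le_trans (opnorm_bilin _ _ _ T1) _; rewrite mulrC.
  rewrite (_ : l2sq n _ = normc (y i) ^+ 2).
    rewrite sqrtr_sqr ger0_norm ?normc_ge0//; apply: ler_wpM2l; first exact: normc_ge0.
    by apply: ler_wsqrtr; apply: ler_sum => j _; rewrite Normc.normcM exprMn.
  rewrite /l2sq (bigD1 i)//= eqxx big1 ?addr0// => l /negPf lj.
  by rewrite -val_eqE in lj; rewrite lj Normc.normc0 expr0n.
Qed.

Lemma schur_bound_le (P A B : pattern) k : P = A `|` B ->
  row_bounded_by k A -> col_bounded_by k B ->
  (schur_bound R P <= (2 * Num.sqrt (k%:R : R))%:E)%E.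
Proof.
move=> PAB rA cB.
apply: ge_ereal_sup => _ [X [XP X1] <-]; apply: ge_ereal_sup => _ [T [_ T1] <-].
apply: ge_ereal_sup => _ [n [x [y [x1 y1 ->]]]]; rewrite lee_fin.
(* Positions in both [A] and [B] go to [Xrow] only, so that the two parts add up to [X]. *)
pose Xrow : mat R := fun i j => if `[< A (i, j) >] then X i j else 0.
pose Xcol : mat R := fun i j => if `[< A (i, j) >] then 0 else X i j.
have Srow : SP A Xrow.
  split=> i j; rewrite /Xrow; case: asboolP => // _; last by rewrite Normc.normc0.
  by rewrite eqxx.
have Scol : SP B Xcol.
  split=> i j; rewrite /Xcol; case: asboolP => //; rewrite ?eqxx//.
    by move=> nA /XP; rewrite PAB => -[].
  by rewrite Normc.normc0.
have -> : bilin (schur X T) n x y = bilin (schur Xrow T) n x y + bilin (schur Xcol T) n x y.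
  rewrite -big_split; apply: eq_bigr => i _; rewrite -big_split; apply: eq_bigr => j _ /=.
  by rewrite /schur /Xrow /Xcol; case: asboolP => _; ring.
apply: le_trans (le_normcD _ _) _; rewrite mulr_natl mulr2n.
apply: lerD; first exact: schur_row_bound Srow rA T1 x1 y1.
exact: schur_col_bound Scol cB T1 x1 y1.
Qed.

End ComplexForms.

(** * Lower bound for Schur multipliers *)

(** Operator norms test forms of every size [N], while a block has its own size [n]; this passes
    between the two ranges. *)
Lemma sum_ord_truncate (V : zmodType) (F : nat -> V) N n :
  (forall i, (n <= i)%N -> F i = 0) ->
  \sum_(i < N) F i = \sum_(i < n) if (i < N)%N then F i else 0.
Proof.
move=> F0; rewrite (big_ord_widen (N + n) F) ?leq_addr//.
rewrite (big_ord_widen (N + n) (fun i => if (i < N)%N then F i else 0)) ?leq_addl//.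
rewrite big_mkcond [RHS]big_mkcond; apply: eq_bigr => i _ /=.
by case: (ltnP i n) => // /F0 ->; case: ifP.
Qed.

Section LowerBound.
Local Open Scope complex_scope.
Variable R : realType.
Local Notation C := R[i].
Local Notation normc := (@Normc.normc R).

Definition ext2 n (f : 'I_n -> 'I_n -> R) (i j : nat) : R :=
  if insub i is Some a then if insub j is Some b then f a b else 0 else 0.

Definition ext1 n (u : 'I_n -> R) (i : nat) : R :=
  if insub i is Some a then u a else 0.

Lemma ext2_ord n (f : 'I_n -> 'I_n -> R) (a b : 'I_n) : ext2 f a b = f a b.
Proof. by rewrite /ext2 !valK. Qed.

Lemma ext1_ord n (u : 'I_n -> R) (a : 'I_n) : ext1 u a = u a.
Proof. by rewrite /ext1 valK. Qed.

Lemma ext2_row_out n (f : 'I_n -> 'I_n -> R) i j : (n <= i)%N -> ext2 f i j = 0.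
Proof. by move=> ni; rewrite /ext2 insubF// ltnNge ni. Qed.

Lemma ext2_col_out n (f : 'I_n -> 'I_n -> R) i j : (n <= j)%N -> ext2 f i j = 0.
Proof. by move=> nj; rewrite /ext2; case: insub => // a; rewrite insubF// ltnNge nj. Qed.

(** A real matrix acts separately on real and imaginary parts, so contracting real vectors is
    enough. *)
Lemma opnorm_real_le1 (z : nat -> nat -> R) :
  (forall N (a : nat -> R),
     \sum_(i < N) (\sum_(j < N) z i j * a j) ^+ 2 <= \sum_(j < N) a j ^+ 2) ->
  (opnorm (fun i j => (z i j)%:C : C) <= 1%:E)%E.
Proof.
move=> zc; apply: ge_ereal_sup => _ [N [x [y [x1 y1 ->]]]]; rewrite lee_fin.
pose g (i : nat) : C := \sum_(j < N) (z i j)%:C * x j.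
have gRe i : complex.Re (g i) = \sum_(j < N) z i j * complex.Re (x j).
  rewrite (big_morph (@complex.Re R) (id1 := 0) (op1 := +%R))//; last by case=> ? ? [].
  by apply: eq_bigr => j _; case: (x j) => a b /=; rewrite mul0r subr0.
have gIm i : complex.Im (g i) = \sum_(j < N) z i j * complex.Im (x j).
  rewrite (big_morph (@complex.Im R) (id1 := 0) (op1 := +%R))//; last by case=> ? ? [].
  by apply: eq_bigr => j _; case: (x j) => a b /=; rewrite mul0r addr0.
have -> : bilin (fun i j => (z i j)%:C) N x y = \sum_(i < N) conjc (y i) * g i.
  by apply: eq_bigr => i _; rewrite mulr_sumr; apply: eq_bigr => j _; rewrite mulrA.
apply: le_trans (normc_sum _) _; rewrite -[leRHS]sqrtr1.
apply: (@sqrt_cauchy_schwarz R N 1 (fun i => normc (y i)) (fun i => normc (g i) ^+ 2)).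
- by move=> i; apply: sqr_ge0.
- exact: y1.
- rewrite (eq_bigr (fun i : 'I_N => complex.Re (g i) ^+ 2 + complex.Im (g i) ^+ 2)).
    rewrite big_split /=; apply: le_trans x1.
    under eq_bigr => i _ do rewrite gRe.
    under [X in _ + X]eq_bigr => i _ do rewrite gIm.
    apply: le_trans (lerD (zc N (fun j => complex.Re (x j)))
      (zc N (fun j => complex.Im (x j)))) _.
    by rewrite -big_split; apply: ler_sum => j _; rewrite normc_sqr.
  by move=> i _; rewrite normc_sqr.
- by move=> i; rewrite sqrtr_sqr ger0_norm ?normc_ge0// Normc.normcM normc_conj.
Qed.

Lemma ext2_contraction n (Z : 'M[R]_n) : (forall x, sqn (x *m Z^T) <= sqn x) ->
  (opnorm (fun i j => (ext2 Z i j)%:C : C) <= 1%:E)%E.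
Proof.
move=> Zc; apply: opnorm_real_le1 => N a.
(* The block sees only the first [n] coordinates of the input; those from [N] on are absent from the
   form and read as 0. *)
pose a' : 'rV[R]_n := \row_j (if (j < N)%N then a j else 0).
have inner (i : 'I_n) : \sum_(j < N) ext2 Z i j * a j = (a' *m Z^T) 0 i.
  rewrite (@sum_ord_truncate _ (fun j => ext2 Z i j * a j) N n); last first.
    by move=> j nj; rewrite ext2_col_out// mul0r.
  rewrite mxE; apply: eq_bigr => j _; rewrite !mxE ext2_ord.
  by case: ifP => _; rewrite ?mul0r// mulrC.
rewrite (@sum_ord_truncate _ (fun i => (\sum_(j < N) ext2 Z i j * a j) ^+ 2) N n).
  apply: (@le_trans _ _ (sqn (a' *m Z^T))).
    apply: ler_sum => i _; case: ifP => _; last exact: sqr_ge0.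
    by rewrite inner.
  apply: le_trans (Zc a') _.
  pose F j := if (j < n)%N then a j ^+ 2 else 0.
  have -> : sqn a' = \sum_(j < N) F j.
    rewrite (@sum_ord_truncate _ F N n) => [|j nj]; last by rewrite /F ltnNge nj.
    apply: eq_bigr => j _; rewrite mxE /F ltn_ord.
    by case: ifP => // _; rewrite expr0n.
  by apply: ler_sum => j _; rewrite /F; case: ifP => // _; apply: sqr_ge0.
move=> i ni; rewrite big1 ?expr0n// => j _.
by rewrite ext2_row_out// mul0r.
Qed.

Lemma l2sq_ext1 n (u : 'I_n -> R) :
  l2sq n (fun i => (ext1 u i)%:C : C) = \sum_i u i ^+ 2.
Proof.
by apply: eq_bigr => i _; rewrite normc_real ext1_ord real_normK ?num_real.
Qed.

Lemma mnorm_ge (X T : mat R) n x y : (opnorm T <= 1%:E)%E -> l2sq n x <= 1 ->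
  l2sq n y <= 1 -> ((normc (bilin (schur X T) n x y))%:E <= mnorm X)%E.
Proof.
move=> T1 x1 y1; apply: (@le_trans _ _ (opnorm (schur X T))).
  by apply: ereal_sup_ubound; exists n, x, y.
apply: ereal_sup_ubound; exists T => //; split=> //.
exact: le_lt_trans T1 (ltry _).
Qed.

(* The bound only depends on the entries of the multiplier in the lines that
   meet [P]; this is what allows independent blocks to be combined. *)
Lemma block_lower_bound (P : pattern) h Rs Cs : uniq Rs -> uniq Cs ->
  (h * (size Rs + size Cs) < count_in P Rs Cs)%N ->
  exists (n : nat) (X : mat R), SP P X /\
    forall X' : mat R,
      (forall i j, (i < n)%N -> (j < n)%N -> (exists l, P (i, l)) ->
         (exists l, P (l, j)) -> X' i j = X i j) ->
      ((Num.sqrt (h.+1%:R : R) / 4)%:E <= mnorm X')%E.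
Proof.
move=> uR uC /(dense_core uR uC)[n [Q [Qne QP Qdeg]]].
have [u [v [b [u1 v1 [uQ vQ] bB pb]]]] := @degree_pairing R n h.+1 Q isT Qne Qdeg.
have [|e [Z [Zc big]]] := sign_selection _ bB pb; first by rewrite sqrtr_gt0 ltr0n.
pose f (i j : 'I_n) : R := (Q i j)%:R * sg R e i j.
have fabs i j : `|f i j| <= 1.
  rewrite normrM /sg normrX normrN1 expr1n mulr1.
  by case: (Q i j); rewrite ?normr1 ?normr0.
exists n, (fun i j => (ext2 f i j)%:C); split.
  split=> i j; last first.
    rewrite normc_real /ext2; case: insub => [a|]; last by rewrite normr0.
    by case: insub => [c|]; rewrite ?normr0.
  rewrite /ext2; case: insubP => [a _ <-|]; last by rewrite eqxx.
  case: insubP => [c _ <-|]; last by rewrite eqxx.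
  rewrite /f; case Qac: (Q a c); first by move=> _; apply: QP.
  by rewrite mul0r eqxx.
move=> X' agree.
pose T : mat R := fun i j => (ext2 Z i j)%:C.
have T1 : (opnorm T <= 1%:E)%E by apply: ext2_contraction.
have x1 : l2sq n (fun i => (ext1 v i)%:C : C) <= 1 by rewrite l2sq_ext1 v1.
have y1 : l2sq n (fun i => (ext1 u i)%:C : C) <= 1 by rewrite l2sq_ext1 u1.
apply: le_trans (mnorm_ge X' T1 x1 y1); rewrite lee_fin.
have -> : bilin (schur X' T) n (fun i => (ext1 v i)%:C) (fun i => (ext1 u i)%:C) =
    (\sum_i \sum_j (\matrix_(i, j) ((Q i j)%:R * (u i * v j))) i j *
      (sg R e i j * Z i j))%:C.
  rewrite rmorph_sum; apply: eq_bigr => i _; rewrite rmorph_sum; apply: eq_bigr => j _.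
  rewrite conjcR !ext1_ord mxE /schur /T ext2_ord.
  (* Either the term vanishes with [u i] or [v j], or both lines meet [P] and [X'] agrees with the
     block there. *)
  have [ui0|/uQ[l Qil]] := eqVneq (u i) 0; first by rewrite ui0 !(mul0r, mulr0).
  have [vj0|/vQ[k Qkj]] := eqVneq (v j) 0; first by rewrite vj0 !(mul0r, mulr0).
  rewrite agree ?ltn_ord//; [|by exists l; apply: QP|by exists k; apply: QP].
  by rewrite ext2_ord -!realcM; congr real_complex_def; rewrite /f; ring.
by rewrite normc_real; apply: le_trans big (ler_norm _).
Qed.

Lemma schur_bound_ge0 (P : pattern) : (0 <= schur_bound R P)%E.
Proof.
have S0 : SP P (fun _ _ => 0 : C).
  by split=> i j; rewrite ?eqxx// Normc.normc0.
apply: (@le_trans _ _ (mnorm (fun _ _ => 0 : C))); last first.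
  by apply: ereal_sup_ubound; exists (fun _ _ => 0).
have T1 : (opnorm (fun _ _ => 0%:C : C) <= 1%:E)%E.
  apply: opnorm_real_le1 => N a; rewrite big1; first by apply: sumr_ge0 => i _; apply: sqr_ge0.
  by move=> i _; rewrite big1 ?expr0n// => j _; rewrite mul0r.
have x1 : l2sq 0 (fun _ => 0 : C) <= 1 by rewrite /l2sq big_ord0.
by apply: le_trans (mnorm_ge _ T1 x1 x1); rewrite lee_fin normc_ge0.
Qed.

(** For [m = h + 1], minimality makes the density bound fail at [h]; the resulting core has all
    degrees above [h], that is at least [m]. *)
Lemma schur_bound_ge (P : pattern) (m : nat) :
  (forall m', (density_sup R P <= (m'%:R)%:E)%E -> (m <= m')%N) ->
  ((Num.sqrt (m%:R : R) / 4)%:E <= schur_bound R P)%E.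
Proof.
case: m => [_|h least]; first by rewrite sqrtr0 mul0r schur_bound_ge0.
have [|Rs [Cs [uR uC viol]]] := @not_density_le R P h.
  by move=> /least; rewrite ltnn.
have [n [X [XP low]]] := block_lower_bound uR uC viol.
by apply: le_trans (low X _) _ => //; apply: ereal_sup_ubound; exists X.
Qed.

Lemma schur_bounded_density (P : pattern) :
  schur_bounded R P -> (density_sup R P < +oo)%E.
Proof.
move=> SB; apply: contrapT => ninf.
(* Lines meeting [tail_pattern P N] have index at least [N], so agreement on the diagonal square
   from [N] to [n] suffices, whatever stands elsewhere. *)
have blocks (p : nat * nat) : exists nX : nat * mat R, SP (tail_pattern P p.1) nX.2 /\
    forall X' : mat R, (forall i j, (p.1 <= i < nX.1)%N -> (p.1 <= j < nX.1)%N ->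
      X' i j = nX.2 i j) -> ((Num.sqrt (p.2.+1%:R : R) / 4)%:E <= mnorm X')%E.
  case: p => N h /=.
  (* The extra [N] pays for the deleted rows and columns. *)
  have [|Rs [Cs [uR uC viol]]] := @not_density_le R P (h + N).
    by move=> le; apply: ninf; apply/ltyP_nat; exists (h + N)%N.
  have [n [X [XP low]]] := block_lower_bound uR uC (count_in_tail uR uC viol).
  exists (n, X); split=> // X' agree; apply: low => i j ni nj [l [_ /= Ni _]] [k [_ _ /= Nj]].
  by apply: agree; rewrite ?Ni ?Nj.
have [F HF] := choice blocks.
(* Block [k] starts at [N k], and the next start lies at or beyond its end; [(N k').+1] forces
   strict growth even if the chosen block ends early. *)
pose N := fix N k := if k is k'.+1 then maxn (N k').+1 (F (N k', k')).1 else 0%N.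
have NS k : (N k < N k.+1)%N by rewrite /= leq_maxl.
have Nmono k l : (k <= l)%N -> (N k <= N l)%N.
  elim: l => [|l IH]; first by rewrite leqn0 => /eqP ->.
  rewrite leq_eqVlt => /orP[/eqP->//|kl]; apply: leq_trans (IH kl) (ltnW (NS l)).
pose blk k i := (N k <= i < N k.+1)%N.
have blk_inj k l i : blk k i -> blk l i -> k = l.
  move=> /andP[ki ik] /andP[li il]; case: (ltngtP k l) => // kl; exfalso.
    by have := Nmono _ _ kl; lia.
  by have := Nmono _ _ kl; lia.
have [X HX] : exists X : mat R, forall i j,
    (forall k, blk k i -> blk k j -> X i j = (F (N k, k)).2 i j) /\
    ((forall k, ~ (blk k i /\ blk k j)) -> X i j = 0).
  have : forall p : nat * nat, exists z : C,
    (forall k, blk k p.1 -> blk k p.2 -> z = (F (N k, k)).2 p.1 p.2) /\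
    ((forall k, ~ (blk k p.1 /\ blk k p.2)) -> z = 0).
    case=> i j /=; have [[k [ki kj]]|nk] := pselect (exists k, blk k i /\ blk k j).
      exists ((F (N k, k)).2 i j); split=> [l li _|/(_ k)/(_ (conj ki kj))//].
      by rewrite (blk_inj _ _ _ ki li).
    by exists 0; split=> // k ki kj; exfalso; apply: nk; exists k.
  by move=> /choice[X HX]; exists (fun i j => X (i, j)) => i j; apply: (HX (i, j)).
have XP : SP P X.
  have alt i j : X i j = 0 \/ exists k, X i j = (F (N k, k)).2 i j.
    have [[k [ki kj]]|nk] := pselect (exists k, blk k i /\ blk k j).
      by right; exists k; apply: (HX i j).1.
    by left; apply: (HX i j).2 => k kij; apply: nk; exists k.
  split=> i j; case: (alt i j) => [->|[k ->]]; rewrite ?eqxx ?Normc.normc0//.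
    by move=> /(HF (N k, k)).1.1 [].
  exact: (HF (N k, k)).1.2.
have low k : ((Num.sqrt (k.+1%:R : R) / 4)%:E <= mnorm X)%E.
  apply: (HF (N k, k)).2 => i j /= /andP[Ni iN] /andP[Nj jN].
  by apply: (HX i j).1; rewrite /blk ?Ni ?Nj /= leq_max ?iN ?jN orbT.
have /ltyP_nat[m Xm] := SB X XP.
(* This index is chosen so that [sqrt (16 (m + 1)^2 + 1) / 4 > m + 1], beyond the supposed bound
   [m]. *)
have := le_trans (low (16 * m.+1 ^ 2)%N) Xm; rewrite lee_fin leNgt => /negP; apply.
rewrite ltr_pdivlMr// -[ltLHS]ger0_norm ?mulr_ge0// -sqrtr_sqr ltr_sqrt ?ltr0n//.
by rewrite -natrM -natrX ltr_nat; lia.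
Qed.

End LowerBound.

(** * Equivalences and the optimal constant *)

Local Open Scope ereal_scope.

Theorem theorem2p3 (R : realType) (P : pattern) :
  (schur_bounded R P <->
     exists A B : pattern, [/\ P = A `|` B, row_finite A & col_finite B]) /\
  ((exists A B : pattern, [/\ P = A `|` B, row_finite A & col_finite B]) <->
     density_sup R P < +oo)%E /\
  (forall m : nat,
     (density_sup R P <= (m%:R)%:E)%E ->
     (forall m' : nat, (density_sup R P <= (m'%:R)%:E)%E -> (m <= m')%N) ->
     [/\ (exists A B : pattern,
            [/\ P = A `|` B, row_bounded_by m A & col_bounded_by m B]),
         (forall k : nat,
            (exists A B : pattern,
               [/\ P = A `|` B, row_bounded_by k A & col_bounded_by k B]) ->
            (m <= k)%N),
         ((Num.sqrt (m%:R : R) / 4)%:E <= schur_bound R P)%E &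
         (schur_bound R P <= (2 * Num.sqrt (m%:R : R))%:E)%E]).
Proof.
have dens_dec m : density_sup R P <= (m%:R)%:E -> exists A B : pattern,
    [/\ P = A `|` B, row_bounded_by m A & col_bounded_by m B].
  by move=> /density_leP/decomposition_of_density.
have dec_dens k A B : P = A `|` B -> row_bounded_by k A -> col_bounded_by k B ->
    density_sup R P <= (k%:R)%:E.
  move=> PAB rA cB; apply/density_leP; apply: count_in_decomposition rA cB.
  by rewrite PAB.
have mono k l A : (k <= l)%N ->
    (row_bounded_by k A -> row_bounded_by l A) /\
    (col_bounded_by k A -> col_bounded_by l A).
  by move=> kl; split=> bA i; have [s [sk As]] := bA i; exists s; split=> //;
    apply: leq_trans kl.
(* Row and column finiteness come with separate constants; their maximum serves for both. *)
have unif : (exists A B : pattern, [/\ P = A `|` B, row_finite A & col_finite B]) ->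
    exists k A B, [/\ P = A `|` B, row_bounded_by k A & col_bounded_by k B].
  move=> [A [B [PAB [k rA] [l cB]]]]; exists (maxn k l), A, B; split=> //.
    by apply: (mono k _ A _).1 rA; rewrite leq_maxl.
  by apply: (mono l _ B _).2 cB; rewrite leq_maxr.
have fin : density_sup R P < +oo ->
    exists A B : pattern, [/\ P = A `|` B, row_finite A & col_finite B].
  move=> /ltyP_nat[m /dens_dec[A [B [PAB rA cB]]]].
  by exists A, B; split=> //; exists m.
split; [|split].
- split=> [/schur_bounded_density/fin//|/unif[k [A [B [PAB rA cB]]]] X XP].
  apply: (@le_lt_trans _ _ (schur_bound R P)).
    by apply: ereal_sup_ubound; exists X.
  exact: le_lt_trans (schur_bound_le R PAB rA cB) (ltry _).
- split=> // /unif[k [A [B [PAB rA cB]]]]; apply/ltyP_nat; exists k.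
  exact: dec_dens PAB rA cB.
- move=> m dm least; split.
  + exact: dens_dec.
  + by move=> k [A [B [PAB rA cB]]]; apply: least; apply: dec_dens PAB rA cB.
  + exact: schur_bound_ge.
  + by have [A [B [PAB rA cB]]] := dens_dec m dm; apply: schur_bound_le PAB rA cB.
Qed.
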